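(* Let $d=2\nu$ be an even integer with $\nu\ge1$ and let $p(x,y)=\sum_{i=0}^{d}\binom{d}{i}c_i\,x^{i}y^{d-i}$ be a real binary form of degree $d$, with $(c_0,\dots,c_d)\in\mathbb{R}^{d+1}\setminus\{\vec 0\}$. Then there exist an open and dense semialgebraic set $\mathcal{G}\subset\mathbb{R}\times\mathbb{R}^{\nu-1}$ and real rational functions $R_1,R_2$ of $(s,s_1,\dots,s_{\nu-1})$, defined on $\mathcal{G}$, such that for every $(s,s_1,\dots,s_{\nu-1})\in\mathcal{G}$ the form $p$ has a real Waring decomposition $$p(x,y)=\sum_{j=1}^{\nu-1}\lambda_{2j-1}(x+s_j y)^d+\sum_{j=1}^{\nu-1}\lambda_{2j}(x-s_j y)^d+\lambda_{d-1}(x+sy)^d+\lambda_d\,(R_1x+R_2y)^d$$ for some real numbers $\lambda_1,\dots,\lambda_d$, where $R_1,R_2$ are evaluated at $(s,s_1,\dots,s_{\nu-1})$ and the $d$ linear forms $x\pm s_jy$ $(1\le j\le\nu-1)$, $x+sy$ and $R_1x+R_2y$ are pairwise non-proportional.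
   Context: A Waring decomposition over $\mathbb{R}$ of a real binary form $p$ of degree $d$ is an expression $p=\sum_{i=1}^r\lambda_i\ell_i^d$ with $\lambda_i\in\mathbb{R}$ and $\ell_i=\alpha_ix+\beta_iy$ real linear forms that are pairwise non-proportional. *)

(* Defs.v *)
From HB Require Import structures.
From mathcomp Require Import all_boot all_order all_algebra.
From mathcomp Require Import all_classical all_reals all_analysis.
(* The notations of mpoly clash with those of mathcomp-analysis. *)
From mathcomp Require Import -(notations) mpoly.

Set Implicit Arguments.
Unset Strict Implicit.
Unset Printing Implicit Defensive.

Import Order.TTheory GRing.Theory Num.Theory.
Import numFieldNormedType.Exports.

Local Open Scope classical_set_scope.
Local Open Scope ring_scope.

Definition formX (R : realType) : mpoly 2 R := mpolyX R (mnm1 ord0).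
Definition formY (R : realType) : mpoly 2 R := mpolyX R (mnm1 ord_max).

Definition binary_form (R : realType) (d : nat) (c : 'I_d.+1 -> R) : mpoly 2 R :=
  \sum_(i < d.+1) ('C(d, i)%:R * c i) *: (formX R ^+ i * formY R ^+ (d - i)).

Definition lform (R : realType) (a b : R) : mpoly 2 R :=
  a *: formX R + b *: formY R.

(* With k = 0 allowed, the zero form is proportional to every form. *)
Definition proportional (R : realType) (l m : mpoly 2 R) : Prop :=
  exists k : R, l = k *: m \/ m = k *: l.

Definition pairwise_nonproportional (R : realType) (ls : seq (mpoly 2 R)) : Prop :=
  forall i j : nat, (i < j < size ls)%N -> ~ proportional ls`_i ls`_j.

(* The coordinates (s, s_1, ..., s_n) of a point of R x R^n, with s at index 0. *)
Definition coords (R : realType) (n : nat) (x : R * 'rV[R]_n) (i : 'I_n.+1) : R :=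
  if unlift ord0 i is Some j then x.2 ord0 j else x.1.

(* A finite union of sets, each given by finitely many polynomial equations
   e = 0 (first list) and strict inequalities g > 0 (second list). *)
Definition semialgebraic (R : realType) (n : nat) (A : set (R * 'rV[R]_n)) : Prop :=
  exists F : seq (seq (mpoly n.+1 R) * seq (mpoly n.+1 R)),
    A = [set x | has (fun eg => all (fun e => meval (coords x) e == 0) eg.1
                             && all (fun g => 0 < meval (coords x) g) eg.2) F].

Definition rational_on (R : realType) (n : nat) (A : set (R * 'rV[R]_n))
    (f : R * 'rV[R]_n -> R) : Prop :=
  exists num den : mpoly n.+1 R, forall x, A x ->
    meval (coords x) den != 0 /\
    f x = meval (coords x) num / meval (coords x) den.

(* Main.v *)
Require Import Defs.
From HB Require Import structures.
From mathcomp Require Import all_boot all_order all_algebra.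
From mathcomp Require Import all_classical all_reals all_analysis.
From mathcomp Require Import -(notations) mpoly.
From mathcomp Require Import ring zify.

Set Implicit Arguments.
Unset Strict Implicit.
Unset Printing Implicit Defensive.

Import Order.TTheory GRing.Theory Num.Theory.
Import numFieldNormedType.Exports.

Local Open Scope classical_set_scope.
Local Open Scope ring_scope.

(** Dehomogenize by x = 1, y = T, and encode the form p by the linear
    functional L on polynomials of degree at most d with L(T^m) = c_(d-m).
    A decomposition of p with affine nodes a (the forms x + a y) and one more
    form U x + V y is then a quadrature formula for L: a combination of the
    evaluations at the a and of the evaluation at the point U x + V y, in the
    homogeneous sense that allows U = 0.

    Prescribe the d - 1 affine nodes s, s_j, - s_j and let A be the monic
    polynomial with these roots.  The last form is found by apolarity: the
    product of A with the linear factor vanishing at [U : V] must be killed by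
    L, which is the single equation U L(T A) = V L(A).  So U = L(A) and
    V = L(T A) will do, and these are polynomials in (s, s_1, ...).  If the
    nodes are distinct and V - a U <> 0 at every node a, the quadrature formula
    exists ([quadrature]): a suitable multiple of the evaluation at [U : V]
    agrees with L on A and on T A, and the difference, which kills every
    multiple of A of degree at most d, is an evaluation at the nodes by
    Lagrange interpolation.  The same conditions say that the d linear forms
    are pairwise non-proportional.

    What remains is genericity.  The good parameters form the nonvanishing
    locus of one polynomial, so they are open, semialgebraic, and dense as soon
    as no factor of that polynomial is identically zero.  The factors that need
    an argument are V - a U = L((T - a) A).  If one of them vanished
    identically, specializing the parameters would give L(B T^(2m)) = 0 for
    many explicit B ([even_powers_span]), and then L = 0, against p <> 0
    ([functional_eq0_of_double_s], [functional_eq0_of_double_t]). *)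

(** * Functionals on polynomials of bounded degree *)

(** The functional that sends 'X^m to [e m], on polynomials of degree at most
    [k].  It is defined over any commutative ring because the coordinates of
    the last linear form are needed both as real numbers and as polynomials in
    the parameters. *)
Definition pairing (K : comNzRingType) (e : nat -> K) (k : nat) (Z : {poly K}) : K :=
  \sum_(m < k.+1) Z`_m * e m.

Lemma pairingD (K : comNzRingType) (e : nat -> K) k :
  {morph pairing e k : Y Z / Y + Z}.
Proof.
by move=> Y Z; rewrite -big_split; apply: eq_bigr => m _; rewrite coefD mulrDl.
Qed.

Lemma pairingZ (K : comNzRingType) (e : nat -> K) k a Z :
  pairing e k (a *: Z) = a * pairing e k Z.
Proof. by rewrite mulr_sumr; apply: eq_bigr => m _; rewrite coefZ mulrA. Qed.

Lemma pairingB (K : comNzRingType) (e : nat -> K) k :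
  {morph pairing e k : Y Z / Y - Z}.
Proof. by move=> Y Z; rewrite -scaleN1r pairingD pairingZ mulN1r. Qed.

Lemma pairing_sum (K : comNzRingType) (e : nat -> K) k (I : Type) (r : seq I)
    (F : I -> {poly K}) :
  pairing e k (\sum_(i <- r) F i) = \sum_(i <- r) pairing e k (F i).
Proof.
elim: r => [|i r IH]; last by rewrite !big_cons pairingD IH.
by rewrite !big_nil -(scale0r 0) pairingZ mul0r.
Qed.

Lemma pairingXn (K : comNzRingType) (e : nat -> K) k m :
  (m <= k)%N -> pairing e k 'X^m = e m.
Proof.
move=> lemk; rewrite /pairing (bigD1 (Ordinal (lemk : m < k.+1)%N)) //= big1.
  by rewrite coefXn eqxx mul1r addr0.
by move=> i; rewrite -val_eqE /= => /negPf ne; rewrite coefXn ne mul0r.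
Qed.

Lemma rmorph_pairing (K K' : comNzRingType) (f : {rmorphism K -> K'}) e k Z :
  f (pairing e k Z) = pairing (f \o e) k (map_poly f Z).
Proof.
by rewrite rmorph_sum; apply: eq_bigr => m _; rewrite coef_map rmorphM.
Qed.

(** The value of the degree-[k] homogenization at [U : V], the point where
    'X = V / U when [U] is invertible. *)
Definition heval (K : comNzRingType) (U V : K) (k : nat) : {poly K} -> K :=
  pairing (fun m => U ^+ (k - m) * V ^+ m) k.

(** In the homogenization, multiplying by 'X multiplies the value by [V],
    while only raising the nominal degree multiplies it by [U]. *)
Lemma hevalMX (K : comNzRingType) (U V : K) k (Z : {poly K}) :
  heval U V k.+1 ('X * Z) = V * heval U V k Z.
Proof.
rewrite /heval /pairing big_ord_recl coefXM mul0r add0r mulr_sumr.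
by apply: eq_bigr => m _; rewrite coefXM /= subSS exprS; ring.
Qed.

Lemma heval_raise (K : comNzRingType) (U V : K) k (Z : {poly K}) :
  (size Z <= k.+1)%N -> heval U V k.+1 Z = U * heval U V k Z.
Proof.
move=> szZ; rewrite /heval /pairing big_ord_recr /= (nth_default _ szZ) mul0r.
rewrite addr0 mulr_sumr; apply: eq_bigr => m _.
by rewrite subSn 1?exprS -1?ltnS //; ring.
Qed.

Lemma heval_prod_XsubC (K : comNzRingType) (U V : K) (s : seq K) :
  heval U V (size s) (\prod_(a <- s) ('X - a%:P)) = \prod_(a <- s) (V - a * U).
Proof.
elim: s => [|a s IH].
  rewrite !big_nil /heval /pairing big_ord_recl big_ord0 coef1 /=.
  by rewrite !expr0; ring.
rewrite !big_cons mulrBl mul_polyC /= /heval pairingB pairingZ.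
rewrite -/(heval _ _ _ _) hevalMX -/(heval _ _ _ _) heval_raise ?size_prod_XsubC //.
by rewrite IH; ring.
Qed.

(** * Quadrature *)

Definition lagrange_basis (K : fieldType) (s : seq K) (a : K) : {poly K} :=
  let l := \prod_(b <- s | b != a) ('X - b%:P) in l.[a]^-1 *: l.

Lemma size_lagrange_basis (K : fieldType) (s : seq K) a :
  a \in s -> (size (lagrange_basis s a) <= size s)%N.
Proof.
move=> sa; apply: leq_trans (size_scale_leq _ _) _.
rewrite -big_filter size_prod_XsubC size_filter -(count_predC (pred1 a) s).
by rewrite -addn1 addnC leq_add2r -has_count has_pred1.
Qed.

Lemma horner_lagrange_basis (K : fieldType) (s : seq K) a b :
  b \in s -> (lagrange_basis s a).[b] = (b == a)%:R.
Proof.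
move=> sb; rewrite /lagrange_basis hornerZ; have [->|neba] := eqVneq b a.
  rewrite mulVf // horner_prod prodf_seq_neq0; apply/allP => c _.
  by rewrite hornerXsubC subr_eq0 eq_sym; apply/implyP.
apply/eqP; rewrite mulf_eq0; apply/orP; right.
by rewrite -/(root _ b) -big_filter root_prod_XsubC mem_filter neba.
Qed.

Lemma lagrange_interpolation (K : fieldType) (s : seq K) (Z : {poly K}) :
  uniq s -> (size Z <= size s)%N ->
  Z = \sum_(a <- s) Z.[a] *: lagrange_basis s a.
Proof.
move=> us szZ; apply/eqP; rewrite -subr_eq0; apply/eqP.
apply: (@roots_geq_poly_eq0 _ _ s) => //; last first.
  apply: leq_trans (size_polyD _ _) _; rewrite geq_max szZ size_polyN.
  rewrite big_seq; apply: (leq_trans (size_sum _ _ _)); apply/bigmax_leqP_seq => a sa _.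
  exact: leq_trans (size_scale_leq _ _) (size_lagrange_basis _).
apply/allP => b sb; rewrite /root hornerD hornerN horner_sum.
rewrite (bigD1_seq b) //= big1_seq => [|a /andP[neab sa]].
  by rewrite hornerZ horner_lagrange_basis // eqxx mulr1 addr0 subrr.
by rewrite hornerZ horner_lagrange_basis // eq_sym (negPf neab) mulr0.
Qed.

Lemma poly_size2E (K : nzRingType) (Q : {poly K}) :
  (size Q <= 2)%N -> Q = (Q`_0)%:P + Q`_1 *: 'X.
Proof.
move=> szQ; apply/polyP => -[|[|i]]; rewrite coefD coefC coefZ coefX /=.
- by rewrite mulr0 addr0.
- by rewrite mulr1 add0r.
by rewrite mulr0 addr0 nth_default ?(leq_trans szQ).
Qed.

(** Matching the values on [A] and on ['X * A] puts two conditions on the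
    weight [w], and the choice of [U] and [V] makes them agree.  These two
    polynomials span the multiples of [A] of degree at most [k], so subtracting
    the evaluation at [U : V] leaves a functional that sees a polynomial only
    modulo [A], that is, through its values on [s]. *)
Lemma quadrature (K : fieldType) (s : seq K) (e : nat -> K) :
    let k := (size s).+1 in
    let A := \prod_(a <- s) ('X - a%:P) in
    let U := pairing e k A in
    let V := pairing e k ('X * A) in
    uniq s -> (forall a, a \in s -> V - a * U != 0) ->
  exists (mu : K -> K) (w : K), forall Z : {poly K}, (size Z <= k.+1)%N ->
    pairing e k Z = \sum_(a <- s) mu a * Z.[a] + w * heval U V k Z.
Proof.
move=> k A U V us nz.
pose w := (\prod_(a <- s) (V - a * U))^-1.
have wK : w * \prod_(a <- s) (V - a * U) = 1.
  by rewrite mulVf // prodf_seq_neq0; apply/allP.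
(* The part of the functional that the affine nodes have to account for. *)
pose L Z := pairing e k Z - w * heval U V k Z.
have LD Y Z : L (Y + Z) = L Y + L Z by rewrite /L /heval !pairingD; ring.
have LZ a Z : L (a *: Z) = a * L Z by rewrite /L /heval !pairingZ; ring.
have LA : L A = 0.
  rewrite /L heval_raise ?size_prod_XsubC // heval_prod_XsubC.
  by rewrite mulrCA wK mulr1 subrr.
have LXA : L ('X * A) = 0.
  by rewrite /L hevalMX heval_prod_XsubC mulrCA wK mulr1 subrr.
exists (fun a => L (lagrange_basis s a)), w => Z szZ.
suff: L Z = \sum_(a <- s) L (lagrange_basis s a) * Z.[a].
  by move=> <-; rewrite /L subrK.
have mA : A \is monic by rewrite monic_prod_XsubC.
have szA : size A = k by rewrite size_prod_XsubC.
have nzA : A != 0 by apply: monic_neq0.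
have szr : (size (Z %% A)%R <= size s)%N.
  by rewrite -ltnS -/k -szA ltn_modp.
have szq : (size (Z %/ A)%R <= 2)%N.
  by rewrite size_divp // szA leq_subLR addn2.
have Zr a : a \in s -> (Z %% A).[a] = Z.[a].
  move=> sa; rewrite [in RHS](divp_eq Z A) hornerD hornerM.
  suff -> : A.[a] = 0 by rewrite mulr0 add0r.
  by apply/eqP; rewrite -/(root A a) root_prod_XsubC.
(* The quotient has degree at most 1, so its contribution is a combination of
   [L A] and [L ('X * A)]. *)
rewrite [in LHS](divp_eq Z A) LD (poly_size2E szq) mulrDl mul_polyC -scalerAl.
rewrite LD !LZ LA LXA !mulr0 !add0r (lagrange_interpolation us szr).
rewrite /L /heval !pairing_sum mulr_sumr -sumrB; apply: eq_big_seq => a sa.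
by rewrite !pairingZ Zr //; ring.
Qed.

(** * Detecting functionals on products of linear factors *)

(** For one index [j] the functional is affine in [t j ^+ 2]; its vanishing at
    [t j = 0] and [t j = 1] separates the terms 'X^2 and 1 of that factor.
    Choosing the term 'X^2 for [m] of the indices and 1 for the others leaves
    'X^(2m). *)
Lemma even_powers_span (K : comNzRingType) (I : eqType) (r : seq I) e k
    (B : {poly K}) :
    uniq r ->
    (forall t : I -> K,
       pairing e k (B * \prod_(j <- r) ('X^2 - (t j ^+ 2)%:P)) = 0) ->
  forall m, (m <= size r)%N -> pairing e k (B * 'X^(2 * m)) = 0.
Proof.
elim: r B => [|j r IH] B /= => [_ H m|/andP[jr ur] H m].
  by rewrite leqn0 => /eqP->; have := H (fun=> 0); rewrite big_nil.
have {}H a t : pairing e k (B * ('X^2 - (a ^+ 2)%:P) *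
    \prod_(i <- r) ('X^2 - (t i ^+ 2)%:P)) = 0.
  (* [t j] is free because [j] does not occur in [r]. *)
  have := H (fun i => if i == j then a else t i).
  rewrite big_cons eqxx mulrA (_ : \prod_(i <- r) _ =
    \prod_(i <- r) ('X^2 - (t i ^+ 2)%:P)) //.
  by apply: eq_big_seq => i ri; case: eqP => // ij; rewrite -ij ri in jr.
have HX t : pairing e k (B * 'X^2 * \prod_(i <- r) ('X^2 - (t i ^+ 2)%:P)) = 0.
  by have := H 0 t; rewrite expr0n subr0.
have H1 t : pairing e k (B * \prod_(i <- r) ('X^2 - (t i ^+ 2)%:P)) = 0.
  have := H 1 t; rewrite expr1n mulrBr mulr1 mulrBl pairingB HX.
  by move/eqP; rewrite sub0r oppr_eq0 => /eqP.
case: m => [|m] lem; first exact: (IH _ ur H1).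
by rewrite mulnS exprD mulrA; apply: IH.
Qed.

(** Quadratic in [b], so three values of [b] determine the coefficients. *)
Lemma square_factor_span (K : numDomainType) (e : nat -> K) k (D : {poly K}) :
    (forall b, pairing e k (('X - b%:P) ^+ 2 * D) = 0) ->
  forall i, (i <= 2)%N -> pairing e k ('X^i * D) = 0.
Proof.
move=> H.
have E b : ('X - b%:P) ^+ 2 * D
    = 'X^2 * D - (2 * b) *: ('X * D) + (b ^+ 2) *: (1 * D).
  by rewrite -!mul_polyC !rmorphM /= rmorph_nat; ring.
have {E}H b : pairing e k ('X^2 * D) - 2 * b * pairing e k ('X * D)
   + b ^+ 2 * pairing e k (1 * D) = 0.
  by rewrite -!pairingZ -pairingB -pairingD -E.
suff [x0 y0 z0] : [/\ pairing e k ('X^2 * D) = 0,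
    pairing e k ('X * D) = 0 & pairing e k (1 * D) = 0] by case=> [|[|[|]]].
have := H 0; have := H 1; have := H (-1).
move: (pairing e k ('X^2 * D)) (pairing e k ('X * D)) (pairing e k (1 * D)).
move=> x y z h1 h2 h3.
have x0 : x = 0 by rewrite -[RHS]h3; ring.
have y0 : y = 0.
  by apply: (@mulfI _ 4); rewrite ?pnatr_eq0 // mulr0 -[RHS](subrr 0) -{1}h1 -h2; ring.
have z0 : z = 0 by rewrite -[RHS]h2 x0 y0; ring.
by [].
Qed.

(** Cubic in [a], with all four coefficients of ('X - a)^2 ('X + a) equal to a
    power of [a] up to sign; four values of [a] isolate them. *)
Lemma cubic_factor_span (K : numDomainType) (e : nat -> K) k (D : {poly K}) :
    (forall a, pairing e k (('X - a%:P) ^+ 2 * ('X + a%:P) * D) = 0) ->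
  forall i, (i <= 3)%N -> pairing e k ('X^i * D) = 0.
Proof.
move=> H.
have E a : ('X - a%:P) ^+ 2 * ('X + a%:P) * D
    = 'X^3 * D - a *: ('X^2 * D) - (a ^+ 2) *: ('X * D) + (a ^+ 3) *: (1 * D).
  by rewrite -!mul_polyC !rmorphXn /=; ring.
have {E}H a : pairing e k ('X^3 * D) - a * pairing e k ('X^2 * D)
   - a ^+ 2 * pairing e k ('X * D) + a ^+ 3 * pairing e k (1 * D) = 0.
  by rewrite -!pairingZ -!pairingB -pairingD -E.
suff [x0 z0 y0 w0] : [/\ pairing e k ('X^3 * D) = 0,
    pairing e k ('X^2 * D) = 0, pairing e k ('X * D) = 0
    & pairing e k (1 * D) = 0] by case=> [|[|[|[|]]]].
have := H 0; have := H 1; have := H (-1); have := H 2.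
move: (pairing e k ('X^3 * D)) (pairing e k ('X^2 * D)).
move: (pairing e k ('X * D)) (pairing e k (1 * D)).
move=> y z w x h1 h2 h3 h4.
have w0 : w = 0 by rewrite -[RHS]h4; ring.
have y0 : y = 0.
  apply: (@mulfI _ (-2)); first by rewrite oppr_eq0 pnatr_eq0.
  by rewrite mulr0 -[RHS](addr0 0) -{1}h2 -h3 w0; ring.
have xz : x = z by apply/eqP; rewrite -subr_eq0 -h2 w0 y0; apply/eqP; ring.
have z0 : z = 0.
  apply: (@mulfI _ 6); rewrite ?pnatr_eq0 // mulr0.
  by rewrite -[RHS]h1 w0 y0 xz; ring.
have x0 : x = 0 by rewrite xz.
by [].
Qed.

(** * The affine nodes of the decomposition *)

Definition nodes (K : nzRingType) (n : nat) (v : 'I_n.+1 -> K) : seq K :=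
  [seq v (lift ord0 j) | j : 'I_n] ++ [seq - v (lift ord0 j) | j : 'I_n]
  ++ [:: v ord0].

Definition node_poly (K : nzRingType) (n : nat) (v : 'I_n.+1 -> K) : {poly K} :=
  \prod_(a <- nodes v) ('X - a%:P).

Lemma size_nodes (K : nzRingType) n (v : 'I_n.+1 -> K) : size (nodes v) = (2 * n).+1.
Proof. by rewrite !size_cat !size_image card_ord /=; lia. Qed.

Lemma node_polyE (K : comNzRingType) n (v : 'I_n.+1 -> K) :
  node_poly v = (\prod_(j < n) ('X^2 - (v (lift ord0 j) ^+ 2)%:P)) * ('X - (v ord0)%:P).
Proof.
rewrite /node_poly !big_cat /= big_seq1 !big_map mulrA -big_split /=.
rewrite -enumT big_enum /=; congr (_ * _); apply: eq_bigr => j _.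
by rewrite rmorphXn rmorphN /=; ring.
Qed.

Lemma map_node_poly (K K' : comNzRingType) (f : {rmorphism K -> K'}) n
    (v : 'I_n.+1 -> K) :
  map_poly f (node_poly v) = node_poly (f \o v).
Proof.
rewrite !node_polyE rmorphM rmorph_prod /= map_polyXsubC; congr (_ * _).
by apply: eq_bigr => j _; rewrite rmorphB /= map_polyXn map_polyC /= rmorphXn.
Qed.

Definition join_coords (K : Type) n (b : K) (t : 'I_n -> K) (i : 'I_n.+1) : K :=
  if unlift ord0 i is Some j then t j else b.

Lemma join_coords0 (K : Type) n (b : K) (t : 'I_n -> K) : join_coords b t ord0 = b.
Proof. by rewrite /join_coords unlift_none. Qed.

Lemma join_coords_lift (K : Type) n (b : K) (t : 'I_n -> K) j :
  join_coords b t (lift ord0 j) = t j.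
Proof. by rewrite /join_coords liftK. Qed.

(** The factor 'X - s occurs twice, and the other factors are even
    in 'X: [even_powers_span] reduces the hypothesis to ('X - b)^2 'X^(2m). *)
Lemma functional_eq0_of_double_s (K : numDomainType) (n : nat) (e : nat -> K) :
    let k := (2 * n).+2 in
    (forall v : 'I_n.+1 -> K,
       pairing e k (('X - (v ord0)%:P) * node_poly v) = 0) ->
  forall i, (i <= k)%N -> e i = 0.
Proof.
move=> k H i leik.
have E b m : (m <= n)%N -> pairing e k (('X - b%:P) ^+ 2 * 'X^(2 * m)) = 0.
  rewrite -[n in (m <= n)%N]size_enum_ord enumT => lemn.
  apply: even_powers_span lemn; first by rewrite -enumT enum_uniq.
  move=> t; have := H (join_coords b t).
  rewrite node_polyE join_coords0 (eq_bigr (fun j => 'X^2 - (t j ^+ 2)%:P)).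
  2: by move=> j _; rewrite join_coords_lift.
  by congr (pairing _ _ _ = _); ring.
have {E} E m l : (m <= n)%N -> (l <= 2)%N -> (l + 2 * m <= k)%N -> e (l + 2 * m)%N = 0.
  move=> lemn lel ?; rewrite -(pairingXn e (k := k)) // exprD.
  by apply: square_factor_span lel => b; apply: E.
(* The top exponent is the 'X^2 coefficient at [m = n]; below it, a remainder
   modulo 2 is enough. *)
have [lein|ltni] := leqP i (2 * n).+1; last first.
  have -> : i = (2 + 2 * n)%N by lia.
  by apply: E => //; lia.
have := E (i %/ 2)%N (i %% 2)%N; rewrite [(_ %% _ + _)%N]addnC [(2 * _)%N]mulnC -divn_eq.
by apply => //; lia.
Qed.

(** The two nodes [t j0] and [- t j0] are treated together through the sign
    [eps], a square root of 1.  The node [eps * t j0] is the one that becomes a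
    double root; substituting [eps * a] for [t j0] turns the factors that
    involve [t j0] into ('X - a)^2 ('X + a) for both signs. *)
Lemma functional_eq0_of_double_t (K : numDomainType) (n : nat) (e : nat -> K) (eps : K)
    (j0 : 'I_n) :
    let k := (2 * n).+2 in
    eps ^+ 2 = 1 ->
    (forall v : 'I_n.+1 -> K,
       pairing e k (('X - (eps * v (lift ord0 j0))%:P) * node_poly v) = 0) ->
  forall i, (i <= k)%N -> e i = 0.
Proof.
move=> k eps2 H i leik.
have n_gt0 : (0 < n)%N by apply: leq_ltn_trans (ltn_ord j0).
have E a b m : (m <= n.-1)%N ->
    pairing e k (('X - a%:P) ^+ 2 * ('X + a%:P) * ('X - b%:P) * 'X^(2 * m)) = 0.
  have -> : n.-1 = size (rem j0 (enum 'I_n)).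
    by rewrite size_rem ?size_enum_ord ?mem_enum.
  move=> lemn; apply: even_powers_span lemn; first by rewrite rem_uniq ?enum_uniq.
  move=> t; have := H (join_coords b (fun j => if j == j0 then eps * a else t j)).
  rewrite node_polyE join_coords0 join_coords_lift eqxx mulrA -expr2 eps2 mul1r.
  rewrite -big_enum /= (big_rem j0) ?mem_enum //= join_coords_lift eqxx.
  rewrite exprMn eps2 mul1r.
  rewrite (_ : \prod_(j <- rem _ _) _ =
      \prod_(j <- rem j0 (enum 'I_n)) ('X^2 - (t j ^+ 2)%:P)); last first.
    apply: eq_big_seq => j; rewrite mem_rem_uniq ?enum_uniq // inE => /andP[ne _].
    by rewrite join_coords_lift (negPf ne).
  by congr (pairing _ _ _ = _); rewrite !rmorphXn /=; ring.
(* Affine in [b]: this gives all powers of 'X below [2 * n], not only the even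
   ones. *)
have {}E a m l : (m <= n.-1)%N -> (l <= 1)%N ->
    pairing e k (('X - a%:P) ^+ 2 * ('X + a%:P) * 'X^(l + 2 * m)) = 0.
  move=> lemn; have E0 := E a 0 m lemn; have := E a 1 m lemn.
  rewrite subr0 in E0; rewrite mulrBr mulr1 mulrBl pairingB E0 sub0r.
  move/eqP; rewrite oppr_eq0 => /eqP E1; case: l => [|[|]] // _.
  by rewrite exprD expr1 mulrA.
have {}E m l : (m < 2 * n)%N -> (l <= 3)%N -> (l + m <= k)%N -> e (l + m)%N = 0.
  move=> ltmn lel ?; rewrite -(pairingXn e (k := k)) // exprD.
  apply: cubic_factor_span lel => a.
  have := E a (m %/ 2)%N (m %% 2)%N.
  rewrite [(_ %% _ + _)%N]addnC [(2 * _)%N]mulnC -divn_eq.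
  by apply; lia.
have [ltin|leni] := ltnP i (2 * n); first exact: (E i 0%N).
(* The top exponents are reached from the largest admissible [m], which is
   [2 * n - 1], by one of the coefficients of the cubic factor. *)
have -> : i = ((i - (2 * n).-1) + (2 * n).-1)%N by lia.
by apply: E; rewrite /k; lia.
Qed.

(** * Nonvanishing loci of polynomials *)

(** A nonzero polynomial cannot have all the points del / (m + 2) as roots. *)
Lemma small_nonroot (R : realFieldType) (p : {poly R}) (del : R) :
  p != 0 -> 0 < del -> exists2 eps, 0 < eps < del & p.[eps] != 0.
Proof.
move=> nzp del_gt0.
pose rs : seq R := [seq del / m.+2%:R | m <- iota 0 (size p)].
have : ~~ all (root p) rs.
  apply/negP => /(max_poly_roots nzp); rewrite map_inj_uniq ?iota_uniq.
    by rewrite size_map size_iota ltnn => /(_ isT).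
  move=> i j /(mulfI (lt0r_neq0 del_gt0))/invr_inj/eqP.
  by rewrite eqr_nat => /eqP[].
case/allPn => eps /mapP[m _ ->] nz; exists (del / m.+2%:R) => //.
by rewrite divr_gt0 ?ltr0Sn //= ltr_pdivrMr ?ltr0Sn // ltr_pMr // ltr1n.
Qed.

(** The restriction of [P] to the line that is at [x] at time 0 and at [y] at
    time 1, which reduces questions on [P] to one variable. *)
Definition on_line (R : comNzRingType) n (x y : 'I_n -> R) (P : mpoly n R) : {poly R} :=
  mmap polyC (fun i => (x i)%:P + (y i - x i) *: 'X) P.

Lemma horner_on_line (R : comNzRingType) n (x y : 'I_n -> R) (P : mpoly n R) eps :
  (on_line x y P).[eps] = meval (fun i => x i + eps * (y i - x i)) P.
Proof.
rewrite /on_line mevalE /mmap horner_sum; apply: eq_bigr => m _.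
rewrite hornerM hornerC horner_prod; congr (_ * _); apply: eq_bigr => i _.
by rewrite horner_exp hornerD hornerC hornerZ hornerX [eps * _]mulrC.
Qed.

Lemma on_line_neq0 (R : comNzRingType) n (x y : 'I_n -> R) (P : mpoly n R) :
  meval x P != 0 \/ meval y P != 0 -> on_line x y P != 0.
Proof.
move=> H; apply/eqP => P0; case: H => /eqP[].
  have := horner_on_line x y P 0; rewrite P0 horner0 => ->.
  by apply: meval_eq => i; rewrite mul0r addr0.
have := horner_on_line x y P 1; rewrite P0 horner0 => ->.
by apply: meval_eq => i; rewrite mul1r addrC subrK.
Qed.

(** On the line joining a nonzero of one factor to a nonzero of the rest, both
    restrict to nonzero polynomials, whose product has a nonroot. *)
Lemma nonvanishing_prod (R : realFieldType) n (I : eqType) (r : seq I)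
    (F : I -> mpoly n R) :
  (forall i, i \in r -> exists v, meval v (F i) != 0) ->
  exists v, meval v (\prod_(i <- r) F i) != 0.
Proof.
elim: r => [_|i r IH H].
  by exists (fun=> 0); rewrite big_nil meval1 oner_neq0.
have [x nzx] := H i (mem_head _ _).
have [j rj|y nzy] := IH; first by apply: H; rewrite inE rj orbT.
have nzp : on_line y x (F i) != 0 by apply: on_line_neq0; right.
have nzq : on_line y x (\prod_(j <- r) F j) != 0 by apply: on_line_neq0; left.
have [eps _] := small_nonroot (mulf_neq0 nzp nzq) ltr01.
rewrite hornerM !horner_on_line => nz.
by exists (fun i => y i + eps * (x i - y i)); rewrite big_cons mevalM.
Qed.

Lemma coords_continuous (R : realType) n (i : 'I_n.+1) :
  continuous (fun x : R * 'rV[R]_n => coords x i).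
Proof.
rewrite /coords; case: unlift => [j|] x; last exact: cvg_fst.
apply: (@continuous_comp _ _ _ snd (fun M : 'rV[R]_n => M ord0 j)); first exact: cvg_snd.
exact: coord_continuous.
Qed.

Lemma meval_coords_continuous (R : realType) n (P : mpoly n.+1 R) :
  continuous (fun x : R * 'rV[R]_n => meval (coords x) P).
Proof.
under eq_fun do rewrite mevalE.
apply: continuous_big => [x|m _ x]; first exact: add_continuous.
apply: continuousM; first exact: cst_continuous.
apply: continuous_big => [{}x|i _ {}x]; first exact: mul_continuous.
apply: (@continuous_comp _ _ _ (fun y => coords y i) (fun z => z ^+ m i)).
  exact: coords_continuous.
exact: exprn_continuous.
Qed.

Definition nonvanishing (R : realType) n (P : mpoly n.+1 R) : set (R * 'rV[R]_n) :=
  [set x | meval (coords x) P != 0].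

Lemma open_nonvanishing (R : realType) n (P : mpoly n.+1 R) :
  open (nonvanishing P).
Proof.
have /continuousP cP := @meval_coords_continuous R n P.
exact: (cP [set y | y != 0] (@open_neq _ 0)).
Qed.

Lemma semialgebraic_nonvanishing (R : realType) n (P : mpoly n.+1 R) :
  semialgebraic (nonvanishing P).
Proof.
exists [:: ([::], [:: P]); ([::], [:: - P])].
apply/seteqP; split=> x; rewrite /nonvanishing /=;
by rewrite mevalN oppr_gt0 !andbT orbF real_neqr_lt ?num_real // orbC.
Qed.

(** On the line from any given point to a nonzero of [P] there are
    points where [P] is nonzero arbitrarily close to the start. *)
Lemma dense_nonvanishing (R : realType) n (P : mpoly n.+1 R) :
  (exists v, meval v P != 0) -> dense (nonvanishing P).
Proof.
move=> [v nzv] O [x Ox] openO.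
pose g (eps : R) : R * 'rV[R]_n :=
  (x.1 + eps * (v ord0 - x.1), x.2 + eps *: (\row_j v (lift ord0 j) - x.2)).
have g_coords eps : coords (g eps) =1 fun i => coords x i + eps * (v i - coords x i).
  move=> i; rewrite /coords; case: unliftP => [j ->|->] //=.
  by rewrite !mxE.
have g0 : g 0 = x by rewrite /g mul0r scale0r !addr0 -surjective_pairing.
have cg : {for 0, continuous g}.
  have c1 : x.1 + eps * (v ord0 - x.1) @[eps --> (0 : R)]
      --> x.1 + 0 * (v ord0 - x.1).
    by apply: cvgD; [exact: cvg_cst|apply: cvgM; [exact: cvg_id|exact: cvg_cst]].
  have c2 : x.2 + eps *: (\row_j v (lift ord0 j) - x.2) @[eps --> (0 : R)]
      --> x.2 + 0 *: (\row_j v (lift ord0 j) - x.2).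
    by apply: cvgD; [exact: cvg_cst|apply: cvgZ; [exact: cvg_id|exact: cvg_cst]].
  exact: (cvg_pair c1 c2).
have : \forall eps \near (0 : R), O (g eps).
  by apply: cg; rewrite g0; apply: open_nbhs_nbhs.
case/nbhs_ballP => del /= del_gt0 ballO.
have [eps /andP[eps_gt0 eps_lt] nz] :=
  small_nonroot (on_line_neq0 (or_intror nzv : meval (coords x) P != 0 \/ _)) del_gt0.
exists (g eps); split; last first.
  by rewrite /nonvanishing /= (meval_eq _ (g_coords eps)) -horner_on_line.
by apply: ballO; rewrite /ball /= sub0r normrN gtr0_norm.
Qed.

(** * Powers of linear forms *)

Lemma lformX (R : realType) (a b : R) d :
  lform a b ^+ d = \sum_(i < d.+1)
    ('C(d, i)%:R * (a ^+ i * b ^+ (d - i))) *: (formX R ^+ i * formY R ^+ (d - i)).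
Proof.
rewrite /lform addrC exprDn; apply: eq_bigr => i _.
rewrite !exprZn -scalerAr -scalerAl !scalerA -scaler_nat scalerA mulrA.
by rewrite [formY R ^+ _ * _]mulrC.
Qed.

Lemma proportional_lform (R : realType) (a b a' b' : R) :
  proportional (lform a b) (lform a' b') -> b' * a = a' * b.
Proof.
have cX (x y : R) : mcoeff (mnm1 ord0) (lform x y) = x.
  by rewrite mcoeffD !mcoeffZ !mcoeffXU /= mulr1 mulr0 addr0.
have cY (x y : R) : mcoeff (mnm1 ord_max) (lform x y) = y.
  by rewrite mcoeffD !mcoeffZ !mcoeffXU /= mulr1 mulr0 add0r.
case=> k [] E.
  have := congr1 (mcoeff (mnm1 ord0)) E; have := congr1 (mcoeff (mnm1 ord_max)) E.
  by rewrite !mcoeffZ !cX !cY => -> ->; ring.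
have := congr1 (mcoeff (mnm1 ord0)) E; have := congr1 (mcoeff (mnm1 ord_max)) E.
by rewrite !mcoeffZ !cX !cY => -> ->; ring.
Qed.

Lemma pairwise_nonproportional_lform (R : realType) (s : seq R) (U V : R) :
    uniq s -> (forall a, a \in s -> V - a * U != 0) ->
  pairwise_nonproportional (rcons [seq lform 1 a | a <- s] (lform U V)).
Proof.
move=> us nz i j; rewrite size_rcons size_map ltnS => /andP[ltij lejs].
rewrite !nth_rcons !size_map (leq_trans ltij lejs).
rewrite (nth_map 0) ?(leq_trans ltij) //.
have [ltjs|lesj] := ltnP j (size s).
  rewrite (nth_map 0) // => /proportional_lform/eqP.
  by rewrite mulr1 mul1r nth_uniq ?(ltn_trans ltij) // gtn_eqF.
rewrite eqn_leq lejs lesj => /proportional_lform/eqP; apply/negP.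
by rewrite mulr1 -subr_eq0 mulrC nz // mem_nth // (leq_trans ltij).
Qed.

(** The index is reversed because 'X stands for y / x, while [c i] is attached
    to x^i y^(d-i). *)
Definition dual_coef (R : realType) d (c : 'I_d.+1 -> R) (m : nat) : R :=
  c (inord (d - m)).

(** Comparing coefficients, the decomposition says that [dual_coef c] is a
    combination of the power sequences of the nodes; this is [quadrature] read
    on the monomials. *)
Lemma waring_at_nodes (R : realType) d (c : 'I_d.+1 -> R) (s : seq R) :
    let A := \prod_(a <- s) ('X - a%:P) in
    let U := pairing (dual_coef c) d A in
    let V := pairing (dual_coef c) d ('X * A) in
    d = (size s).+1 -> uniq s -> (forall a, a \in s -> V - a * U != 0) ->
  exists (mu : R -> R) (w : R),
    binary_form c = \sum_(a <- s) mu a *: lform 1 a ^+ d + w *: lform U V ^+ d.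
Proof.
move=> A U V dE us nz.
have [] := @quadrature R s (dual_coef c) us; first by rewrite -dE.
rewrite -dE -/A -/U -/V => mu [w H]; exists mu, w.
clearbody U V; clear A nz.
have {}H (i : 'I_d.+1) :
    c i = \sum_(a <- s) mu a * a ^+ (d - i) + w * (U ^+ i * V ^+ (d - i)).
  have := H 'X^(d - i); rewrite size_polyXn ltnS leq_subr => /(_ isT).
  have lei : (i <= d)%N by rewrite -ltnS.
  rewrite /heval 2?pairingXn ?leq_subr // /dual_coef subKn // inord_val => ->.
  by under eq_bigr do rewrite hornerXn.
rewrite lformX scaler_sumr.
under [X in _ = X + _]eq_bigr do rewrite lformX scaler_sumr.
rewrite exchange_big -big_split; apply: eq_bigr => i _ /=.
rewrite H mulrDr scalerDl scalerA mulr_sumr scaler_suml; congr (_ + _).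
  by apply: eq_bigr => a _; rewrite scalerA expr1n mul1r mulrCA.
by rewrite mulrCA.
Qed.

(** * Generic parameters *)

Lemma uniq_nodes (R : realDomainType) n (v : 'I_n.+1 -> R) :
    (forall j, v (lift ord0 j) != 0) ->
    (forall i j, i != j -> v i ^+ 2 - v j ^+ 2 != 0) ->
  uniq (nodes v).
Proof.
move=> nz sq_inj.
have inj i j : v i ^+ 2 = v j ^+ 2 -> i = j.
  move=> E; apply/eqP; have [//|/sq_inj] := eqVneq i j.
  by rewrite E subrr eqxx.
have neg_inj i j : v i = - v j -> i = j by move=> E; apply: inj; rewrite E sqrrN.
rewrite /nodes !cat_uniq /= has_cat /= orbF negb_or andbT.
apply/and3P; split.
- rewrite map_inj_uniq -?enumT ?enum_uniq // => i j E.
  by apply: (@lift_inj _ ord0); apply: inj; rewrite E.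
- apply/andP; split.
    apply/hasPn => _ /codomP[j ->]; apply/negP => /= /codomP[i E].
    move: (E); rewrite (neg_inj _ _ (esym E)) => /esym/eqP.
    by rewrite -subr_eq0 opprK -mulr2n mulrn_eq0 (negPf (nz _)).
  apply/negP => /= /codomP[j E]; have := inj ord0 (lift ord0 j).
  by rewrite E => /(_ erefl)/eqP; rewrite (negPf (neq_lift _ _)).
rewrite map_inj_uniq -?enumT ?enum_uniq //=.
  rewrite orbF; apply/negP => /codomP[j /neg_inj/eqP].
  by rewrite (negPf (neq_lift _ _)).
by move=> i j /oppr_inj E; apply: (@lift_inj _ ord0); apply: inj; rewrite E.
Qed.

(** The coordinates of the last linear form as polynomials in the parameters:
    [quadrature]'s [U] and [V] at the universal point. *)
Definition generic_values (R : realType) n (e : nat -> R) : mpoly n.+1 R * mpoly n.+1 R :=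
  let A := node_poly (fun i : 'I_n.+1 => mpolyX R (mnm1 i)) in
  let k := (2 * n).+2 in
  (pairing (fun m => mpolyC n.+1 (e m)) k A,
   pairing (fun m => mpolyC n.+1 (e m)) k ('X * A)).

Lemma meval_generic_values (R : realType) n (e : nat -> R) (v : 'I_n.+1 -> R) :
  meval v (generic_values n e).1 = pairing e (2 * n).+2 (node_poly v) /\
  meval v (generic_values n e).2 = pairing e (2 * n).+2 ('X * node_poly v).
Proof.
have E1 : meval v \o (fun m => mpolyC n.+1 (e m)) = e.
  by apply/funext => m; rewrite /= mevalC.
have E2 : meval v \o (fun i : 'I_n.+1 => mpolyX R (mnm1 i)) = v.
  by apply/funext => i; rewrite /= mevalXU.
split; rewrite [LHS](rmorph_pairing (meval v)) ?rmorphM /= ?map_polyX.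
  by rewrite [X in pairing _ _ X](map_node_poly (meval v)) E1 E2.
by rewrite [X in pairing _ _ (_ * X)](map_node_poly (meval v)) E1 E2.
Qed.

(** V - N U is the value of the functional at ('X - N) times the node
    polynomial, in which the node [N] is a double root. *)
Lemma generic_direction_neq (R : realType) n (e : nat -> R) (N : mpoly n.+1 R) :
    (exists2 i, (i <= (2 * n).+2)%N & e i != 0) ->
    N \in nodes (fun i : 'I_n.+1 => mpolyX R (mnm1 i)) ->
  exists v, meval v ((generic_values n e).2 - N * (generic_values n e).1) != 0.
Proof.
move=> [i lei nzi] NX.
have E v : meval v ((generic_values n e).2 - N * (generic_values n e).1)
    = pairing e (2 * n).+2 (('X - (meval v N)%:P) * node_poly v).
  have [E1 E2] := meval_generic_values e v.
  by rewrite mevalB mevalM E1 E2 mulrBl pairingB mul_polyC pairingZ.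
suff H : (forall v, pairing e (2 * n).+2 (('X - (meval v N)%:P) * node_poly v) = 0)
    -> e i = 0.
  apply: contrapT => nex; move/eqP: nzi; apply; apply: H => v.
  by rewrite -E; apply: contrapT => /eqP ?; apply: nex; exists v.
move: NX; rewrite !mem_cat => /or3P[/codomP[j ->]|/codomP[j ->]|].
- move=> H; apply: (@functional_eq0_of_double_t R n e 1 j) lei; first by rewrite expr1n.
  by move=> v; rewrite -[RHS](H v) mevalXU mul1r.
- move=> H; apply: (@functional_eq0_of_double_t R n e (-1) j) lei.
    by rewrite sqrrN expr1n.
  by move=> v; rewrite -[RHS](H v) mevalN mevalXU mulN1r.
rewrite inE => /eqP -> H; apply: (@functional_eq0_of_double_s R n e) lei => v.
by rewrite -[RHS](H v) mevalXU.
Qed.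

(** Nonvanishing of the first two families means that the nodes are distinct:
    t_j <> - t_j, and no two parameters agree up to sign.  The third family
    keeps the last linear form away from the nodes. *)
Definition genericity_factors (R : realType) n (e : nat -> R) : seq (mpoly n.+1 R) :=
  let X := fun i : 'I_n.+1 => mpolyX R (mnm1 i) in
  let g := generic_values n e in
  [seq X (lift ord0 j) | j : 'I_n]
  ++ [seq X p.1 ^+ 2 - X p.2 ^+ 2 | p <- enum [pred p : 'I_n.+1 * 'I_n.+1 | p.1 != p.2]]
  ++ [seq g.2 - N * g.1 | N <- nodes X].

Lemma genericity_factors_nonvanishing (R : realType) n (e : nat -> R) :
    (exists2 i, (i <= (2 * n).+2)%N & e i != 0) ->
  forall Q, Q \in genericity_factors n e -> exists v, meval v Q != 0.
Proof.
move=> nze Q; rewrite !mem_cat => /or3P[/codomP[j ->]|/mapP[[i j]]|/mapP[N NX ->]].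
- by exists (fun=> 1); rewrite mevalXU oner_neq0.
- rewrite mem_enum inE /= => neij ->; exists (fun l => (l == i)%:R).
  rewrite mevalB !expr2 !mevalM !mevalXU eqxx [j == i]eq_sym (negPf neij).
  by rewrite mul0r subr0 mulr1 oner_neq0.
exact: generic_direction_neq.
Qed.

Lemma generic_point (R : realType) n (e : nat -> R) (v : 'I_n.+1 -> R) :
    let U := pairing e (2 * n).+2 (node_poly v) in
    let V := pairing e (2 * n).+2 ('X * node_poly v) in
    meval v (\prod_(Q <- genericity_factors n e) Q) != 0 ->
  uniq (nodes v) /\ (forall a, a \in nodes v -> V - a * U != 0).
Proof.
move=> U V; rewrite rmorph_prod prodf_seq_neq0 => /allP /= nz.
have {}nz Q : Q \in genericity_factors n e -> meval v Q != 0.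
  by move=> QX; have := nz Q QX.
split.
  apply: uniq_nodes => [j|i j neij].
    rewrite -(mevalXU v); apply: nz; rewrite !mem_cat; apply/or3P/Or31.
    by apply/codomP; exists j.
  rewrite -!(mevalXU v) !expr2 -!mevalM -mevalB -!expr2; apply: nz.
  rewrite !mem_cat; apply/or3P/Or32; apply/mapP; exists (i, j) => //.
  by rewrite mem_enum.
have [E1 E2] := meval_generic_values e v.
have Em N : N \in nodes (fun i : 'I_n.+1 => mpolyX R (mnm1 i)) ->
    V - meval v N * U != 0.
  move=> NX; rewrite /U /V -E1 -E2 -mevalM -mevalB; apply: nz.
  by rewrite !mem_cat; apply/or3P/Or33/mapP; exists N.
have nodesE : nodes v = [seq meval v N | N <- nodes (fun i => mpolyX R (mnm1 i))].
  rewrite /nodes !map_cat /image_mem -!map_comp.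
  congr (_ ++ (_ ++ _)); last by rewrite /= mevalXU.
    by apply: eq_map => j; rewrite /= mevalXU.
  by apply: eq_map => j; rewrite /= mevalN mevalXU.
by rewrite nodesE => a /mapP[N NX ->]; apply: Em.
Qed.

Theorem theorem2p4 (R : realType) (d nu : nat) (hnu : (1 <= nu)%N)
    (hd : d = (2 * nu)%N) (c : 'I_d.+1 -> R) (hc : exists i, c i <> 0) :
  exists (G : set (R * 'rV[R]_(nu.-1))) (R1 R2 : R * 'rV[R]_(nu.-1) -> R),
    [/\ open G, dense G, semialgebraic G, rational_on G R1 & rational_on G R2] /\
    forall (s : R) (t : 'rV[R]_(nu.-1)), G (s, t) ->
      (exists lam : nat -> R,
         binary_form c =
           \sum_(j < nu.-1) lam (2 * j + 1)%N *: lform 1 (t ord0 j) ^+ d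
           + \sum_(j < nu.-1) lam (2 * j + 2)%N *: lform 1 (- t ord0 j) ^+ d
           + lam d.-1 *: lform 1 s ^+ d
           + lam d *: lform (R1 (s, t)) (R2 (s, t)) ^+ d) /\
      pairwise_nonproportional
        ([seq lform 1 (t ord0 j) | j : 'I_(nu.-1)]
         ++ [seq lform 1 (- t ord0 j) | j : 'I_(nu.-1)]
         ++ [:: lform 1 s; lform (R1 (s, t)) (R2 (s, t))]).
Proof.
case: nu hnu hd => // n _ hd; rewrite /=.
have dE : d = (2 * n).+2 by rewrite hd mulnS.
clear hd; subst d; set d := (2 * n).+2 in c hc *.
pose e := dual_coef c.
have nze : exists2 i, (i <= d)%N & e i != 0.
  have [i /eqP ci] := hc; exists (d - i)%N; first exact: leq_subr.
  by rewrite /e /dual_coef subKn -1?ltnS // inord_val.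
pose g := generic_values n e.
have rat (G : set (R * 'rV[R]_n)) (P : mpoly n.+1 R) :
    rational_on G (fun x => meval (coords x) P).
  by exists P, 1 => x _; rewrite meval1 oner_neq0 divr1.
exists (nonvanishing (\prod_(Q <- genericity_factors n e) Q)),
  (fun x => meval (coords x) g.1), (fun x => meval (coords x) g.2).
split.
  split=> //.
  - exact: open_nonvanishing.
  - apply: dense_nonvanishing; apply: nonvanishing_prod.
    exact: genericity_factors_nonvanishing.
  - exact: semialgebraic_nonvanishing.
move=> s t Gst; pose v := coords (s, t).
have vs : v ord0 = s by rewrite /v /coords unlift_none.
have vt j : v (lift ord0 j) = t ord0 j by rewrite /v /coords liftK.
have [us nz] := generic_point Gst.
have [U_E V_E] := meval_generic_values e v.
rewrite -/v /g U_E V_E.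
set U := pairing e _ (node_poly v); set V := pairing e _ ('X * _).
have nodesE : nodes v =
    [seq t ord0 j | j : 'I_n] ++ [seq - t ord0 j | j : 'I_n] ++ [:: s].
  by rewrite /nodes vs; congr (_ ++ (_ ++ _)); apply: eq_map => j; rewrite vt.
split; last first.
  have := pairwise_nonproportional_lform us nz.
  by rewrite -/v nodesE !map_cat /image_mem -!map_comp -cats1 -!catA.
have [|mu [w ->]] := waring_at_nodes _ us nz; first by rewrite size_nodes.
pose tn m := if insub m is Some j then t ord0 j else 0.
have tnE (j : 'I_n) : tn j = t ord0 j by rewrite /tn valK.
pose lam m := if m == d then w else if m == d.-1 then mu s
  else if odd m then mu (tn m./2) else mu (- tn m./2.-1).
have lam_odd (j : 'I_n) : lam (2 * j + 1)%N = mu (t ord0 j).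
  have ltj := ltn_ord j; rewrite /lam !ltn_eqF /d; try lia.
  by rewrite mul2n addn1 /= odd_double uphalf_double tnE.
have lam_even (j : 'I_n) : lam (2 * j + 2)%N = mu (- t ord0 j).
  have ltj := ltn_ord j; rewrite /lam !ltn_eqF /d; try lia.
  by rewrite mul2n addn2 /= odd_double /= doubleK tnE.
have lam_s : lam d.-1 = mu s by rewrite /lam ltn_eqF // eqxx.
have lam_d : lam d = w by rewrite /lam eqxx.
exists lam; rewrite lam_s lam_d; congr (_ + _).
rewrite nodesE !big_cat big_seq1 !big_image /= addrA.
by congr (_ + _ + _); apply: eq_bigr => j _; rewrite ?lam_odd ?lam_even.
Qed.
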